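(* (Maximum principle.) Let $\Omega$ be a subgraph of a host graph with $\partial\Omega\ne\emptyset$ and let $T>0$. Let $k:\Omega\times(0,T]\to\mathbb{R}$ be bounded, and let $\alpha,\beta:\partial\Omega\times[0,T]\to\mathbb{R}$ satisfy $\alpha\ge 0$, $\beta\ge 0$ and $\alpha+\beta>0$. Suppose $v:\overline{\Omega}\times[0,T]\to\mathbb{R}$ satisfies $v\in C^1(\Omega\times(0,T])\cap C^0(\Omega\times[0,T])$ and $$v_t-\Delta_\Omega v-k(x,t)v\ge 0\ \text{ on }\Omega\times(0,T],\qquad v(x,0)\ge 0\ \text{ on }\Omega,\qquad \alpha(x,t)v+\beta(x,t)\frac{\partial v}{\partial_\Omega n}\ge 0\ \text{ on }\partial\Omega\times[0,T].$$ Then $v(x,t)\ge 0$ on $\overline{\Omega}\times[0,T]$.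
   Context: The host graph $G=(V,E)$ is finite, undirected and connected, with weight $\omega:V\times V\to[0,\infty)$, $\omega_{xy}=\omega_{yx}$, $\omega_{xy}=0$ iff $xy\notin E$, and measure $\mu:V\to(0,\infty)$. $\Omega$ is a connected, simple, induced subgraph (identified with its vertex set); $\partial\Omega=\{z\in V\setminus\Omega: z\sim y\text{ for some }y\in\Omega\}$ and $\overline{\Omega}=\Omega\cup\partial\Omega$. For $x\in\Omega$, $\Delta_\Omega u(x)=\sum_{y\in\overline{\Omega}}(u(y)-u(x))\frac{\omega_{yx}}{\mu(x)}$ (acting in $x$). For $z\in\partial\Omega$, $\frac{\partial u}{\partial_\Omega n}(z)=\sum_{y\in\Omega}(u(z)-u(y))\frac{\omega_{zy}}{\mu(z)}$. For a vertex set $A$ and interval $I$, $C^n(A\times I)$ denotes functions $u$ with $u(x,\cdot)$ $n$ times continuously differentiable on $I$ for each $x\in A$ (one-sided at included endpoints). *)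

(* Defs.v *)
From mathcomp Require Import all_boot all_order all_algebra.
From mathcomp Require Import all_classical all_reals all_analysis.
Set Implicit Arguments.
Unset Strict Implicit.
Unset Printing Implicit Defensive.
Import Order.TTheory GRing.Theory Num.Theory.
Import numFieldNormedType.Exports.
Local Open Scope classical_set_scope.
Local Open Scope ring_scope.

Record host_graph (R : realType) (V : finType) := HostGraph {
  edge : rel V;
  weight : V -> V -> R;
  vmeas : V -> R;
  edge_sym : symmetric edge;
  host_connected : forall x y, connect edge x y;
  weight_ge0 : forall x y, 0 <= weight x y;
  weight_sym : forall x y, weight x y = weight y x;
  weight_eq0 : forall x y, weight x y = 0 <-> ~~ edge x y;
  vmeas_gt0 : forall x, 0 < vmeas x
}.

Section Subgraph.
Variables (R : realType) (V : finType) (G : host_graph R V).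

Definition induced_edge (Omega : {set V}) : rel V :=
  [rel x y | [&& x \in Omega, y \in Omega & edge G x y]].

(* An induced subgraph is identified with its vertex set; since edges form a
   relation, "simple" only has to exclude loops. Loops of the host graph outside
   Omega are allowed. *)
Definition simple_connected (Omega : {set V}) : Prop :=
  {in Omega, forall x, ~~ edge G x x} /\
  {in Omega &, forall x y, connect (induced_edge Omega) x y}.

Definition bdry (Omega : {set V}) : {set V} :=
  [set z | (z \notin Omega) && [exists y in Omega, edge G z y]]%SET.

Definition gclosure (Omega : {set V}) : {set V} := Omega :|: bdry Omega.

Definition laplacian (Omega : {set V}) (u : V -> R) (x : V) : R :=
  \sum_(y in gclosure Omega) (u y - u x) * (weight G y x / vmeas G x).

Definition normal_derivative (Omega : {set V}) (u : V -> R) (z : V) : R :=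
  \sum_(y in Omega) (u z - u y) * (weight G z y / vmeas G z).

End Subgraph.

Section OneSided.
Variable R : realType.

(* Differentiation relative to I: the difference quotient is only taken at
   points of I, so that it is one-sided at the endpoints belonging to I. *)
Definition derivable_within (I : set R) (f : R -> R) (t : R) : Prop :=
  cvg ((f s - f t) / (s - t) @[s --> within I t^']).

Definition derive_within (I : set R) (f : R -> R) (t : R) : R :=
  lim ((f s - f t) / (s - t) @[s --> within I t^']).

Fixpoint Cn_on (n : nat) (I : set R) (f : R -> R) : Prop :=
  if n is m.+1 then
    (forall t, I t -> derivable_within I f t) /\ Cn_on m I (derive_within I f)
  else {within I, continuous f}.

Definition Cn (V : finType) (n : nat) (A : {set V}) (I : set R)
  (u : V -> R -> R) : Prop := {in A, forall x, Cn_on n I (u x)}.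

End OneSided.

(* Main.v *)
Require Import Defs.
From mathcomp Require Import all_boot all_order all_algebra.
From mathcomp Require Import all_classical all_reals all_analysis.
From mathcomp Require Import ring lra.
Import Order.TTheory GRing.Theory Num.Theory.
Import numFieldNormedType.Exports.
Local Open Scope classical_set_scope.
Local Open Scope ring_scope.

(** Fix [lam] larger than every value of [k] and damp the solution:
    [w y s = v y s * expR (- (lam * s))]. If [v] is negative somewhere in
    [Omega], then [w] attains a negative minimum over the finite set [Omega]
    and the compact interval [[0, T]], say at [(y, s)]; the initial condition
    gives [0 < s]. Two facts at [(y, s)] contradict the differential
    inequality.

    In space, [v _ s] is minimal at [y] over the whole closure of [Omega], so
    the Laplacian is nonnegative there. On [Omega] this is the choice of [y];
    on the boundary, where [v] need not even be continuous in time, it comes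
    from [robin_not_strict_min]: at a fixed time a negative boundary value is
    never strictly below all values in [Omega].

    In time, [v y r >= v y s * expR (lam * (r - s))] for [r < s], with equality
    at [r = s], whence [v_t <= lam * v] by [derive_within_le_of_left_minorant].
    A comparison from the left is all that is available when [s = T].

    Together, [lam * v >= v_t >= Delta v + k * v >= k * v] at [(y, s)], which
    is impossible as [v < 0] and [k < lam]. Nonnegativity on the boundary then
    follows from nonnegativity in [Omega] by [robin_not_strict_min] again. *)

Set Implicit Arguments.
Unset Strict Implicit.

(** Difference quotients at points on the left of [t] have a negative
    denominator, so a minorant that touches [f] at [t] has the larger
    quotients, hence the larger derivative. *)
Lemma derive_within_le_of_left_minorant (R : realType) (I : set R)
    (f g : R -> R) (a t l : R) :
  a < t -> `]a, t[ `<=` I -> derivable_within I f t -> is_derive t 1 g l ->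
  f t = g t -> (forall s, a < s < t -> g s <= f s) ->
  derive_within I f t <= l.
Proof.
(* [q] is the difference quotient of [g], continuously extended to [t]. *)
move=> at_ subI df /is_derive1_caratheodory[q [gq qcont <-]] fgt gf.
have left_I : t^'- `=>` within I t^'.
  move=> A; rewrite /= /at_left /within/= => wA.
  near=> s => st.
  have sa : a < s by near: s; exact: lt_nbhsr.
  have nA : s != t -> I s -> A s by near: s.
  by apply: nA; [rewrite lt_eqF|apply: subI; rewrite /= in_itv/= sa].
apply: (@ler_cvg_to _ t^'- _ _
  (fun s => (f s - f t) / (s - t)) q).
- by apply: cvg_trans df; apply: cvg_app.
- by apply: cvg_at_left_filter; exact: qcont.
near=> s.
have st : s < t by near: s; exact: nbhs_left_lt.
have sa : a < s by near: s; exact: nbhs_left_gt.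
rewrite ler_ndivrMr ?subr_lt0// -gq fgt lerD2r.
by apply: gf; rewrite sa st.
Unshelve. all: by end_near. Qed.

Section GraphMinima.
Variables (R : realType) (V : finType) (G : host_graph R V).
Implicit Types (Omega : {set V}) (u : V -> R).

Lemma weight_gt0 x y : edge G x y -> 0 < weight G x y.
Proof.
move=> exy; rewrite lt_def weight_ge0 andbT; apply/eqP => /weight_eq0.
by rewrite exy.
Qed.

(** If [u z] were strictly below all of [u] on [Omega], then the normal
    derivative at [z] would be negative, because [z] has at least one neighbour
    in [Omega]; and [u z < 0] by assumption. As [a] and [b] are not both [0],
    the combination in the boundary condition would then be negative. *)
Lemma robin_not_strict_min Omega u z (a b : R) :
  z \in bdry G Omega -> 0 <= a -> 0 <= b -> 0 < a + b ->
  0 <= a * u z + b * normal_derivative G Omega u z ->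
  u z < 0 -> exists2 y, y \in Omega & u y <= u z.
Proof.
rewrite inE => /andP[_ /existsP[y0 /andP[y0O ezy0]]] a0 b0 ab robin uz.
apply: contrapT => no_y.
have lt_u y : y \in Omega -> u z < u y.
  by move=> yO; rewrite ltNge; apply/negP => uyz; apply: no_y; exists y.
have dn_lt0 : normal_derivative G Omega u z < 0.
  rewrite /normal_derivative (bigD1 y0)//= ltr_wnDr//.
    apply: sumr_le0 => y /andP[yO _]; rewrite mulr_le0_ge0//.
      by rewrite subr_le0 ltW// lt_u.
    by rewrite divr_ge0// ?weight_ge0// ltW// vmeas_gt0.
  rewrite nmulr_rlt0 ?subr_lt0 ?lt_u//.
  by rewrite divr_gt0 ?weight_gt0 ?vmeas_gt0.
move: robin; apply/negP; rewrite -ltNge.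
have [a_gt0|] := ltP 0 a.
  by rewrite ltr_wnDr// ?pmulr_rlt0// mulr_ge0_le0// ltW.
move=> a_le0; have a_eq0 : a = 0 by apply/eqP; rewrite eq_le a_le0.
by move: ab; rewrite a_eq0 add0r mul0r add0r => b_gt0; rewrite pmulr_rlt0.
Qed.

Lemma laplacian_ge0_at_min Omega u x :
  {in gclosure G Omega, forall y, u x <= u y} -> 0 <= laplacian G Omega u x.
Proof.
move=> umin; apply: sumr_ge0 => y yO.
by rewrite mulr_ge0 ?subr_ge0 ?umin// divr_ge0 ?weight_ge0// ltW// vmeas_gt0.
Qed.

End GraphMinima.

Lemma finite_family_min (R : realType) (V : finType) (A : {set V})
    (w : V -> R -> R) (a b : R) x0 :
  x0 \in A -> a <= b -> {in A, forall x, {within `[a, b], continuous (w x)}} ->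
  exists x t, [/\ x \in A, a <= t <= b &
    forall y s, y \in A -> a <= s <= b -> w x t <= w y s].
Proof.
move=> x0A ab wcont.
have /choice[c cP] : forall x, exists c, x \in A ->
    a <= c <= b /\ forall s, a <= s <= b -> w x c <= w x s.
  move=> x; have [xA|_] := boolP (x \in A); last by exists a.
  have [c] := EVT_min ab (wcont x xA).
  by rewrite in_itv/= => cab cmin; exists c.
case: (arg_minP (fun x => w x (c x)) x0A) => x xA xmin.
exists x, (c x); split=> //; first by have [] := cP x xA.
move=> y s yA sab; apply: le_trans (xmin y yA) _.
by have [_] := cP y yA; apply.
Qed.

Lemma is_derive_exp_through (R : realType) (c lam t : R) :
  is_derive t 1 (fun s => c * expR (lam * (s - t))) (lam * c).
Proof.
apply: is_derive_eq.
by rewrite subrr mulr0 expR0 subr0 mul1r /GRing.scale/= mulr1 mulrC.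
Qed.

Unset Implicit Arguments.
Set Strict Implicit.

Theorem theorem3p4 (R : realType) (V : finType) (G : host_graph R V)
  (Omega : {set V}) (T : R) (k alpha beta v : V -> R -> R)
  (hOmega : simple_connected G Omega)
  (hbdry : bdry G Omega != finset.set0)
  (hT : 0 < T)
  (hk : exists M : R, forall (x : V) (t : R), x \in Omega -> 0 < t <= T -> `|k x t| <= M)
  (halpha : forall (z : V) (t : R), z \in bdry G Omega -> 0 <= t <= T -> 0 <= alpha z t)
  (hbeta : forall (z : V) (t : R), z \in bdry G Omega -> 0 <= t <= T -> 0 <= beta z t)
  (halphabeta : forall (z : V) (t : R), z \in bdry G Omega -> 0 <= t <= T ->
     0 < alpha z t + beta z t)
  (hC1 : Cn 1 Omega `]0, T] v)
  (hC0 : Cn 0 Omega `[0, T] v)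
  (hpde : forall (x : V) (t : R), x \in Omega -> 0 < t <= T ->
     0 <= derive_within `]0, T] (v x) t
          - laplacian G Omega (fun y => v y t) x - k x t * v x t)
  (hinit : forall x, x \in Omega -> 0 <= v x 0)
  (hbc : forall (z : V) (t : R), z \in bdry G Omega -> 0 <= t <= T ->
     0 <= alpha z t * v z t
          + beta z t * normal_derivative G Omega (fun y => v y t) z) :
  forall (x : V) (t : R), x \in gclosure G Omega -> 0 <= t <= T -> 0 <= v x t.
Proof.
have boundary_controlled z t : z \in bdry G Omega -> 0 <= t <= T ->
    v z t < 0 -> exists2 y, y \in Omega & v y t <= v z t.
  move=> zB tT; apply: (robin_not_strict_min (u := fun y => v y t) zB).
  - exact: halpha zB tT.
  - exact: hbeta zB tT.
  - exact: halphabeta.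
  - exact: hbc.
suff interior x t : x \in Omega -> 0 <= t <= T -> 0 <= v x t.
  move=> x t; rewrite finset.in_setU => /orP[xO|xB] tT; first exact: interior.
  rewrite leNgt; apply/negP => vneg.
  have [y yO yx] := boundary_controlled x t xB tT vneg.
  by have := le_lt_trans yx vneg; rewrite ltNge interior.
move=> x0O t0T; rewrite leNgt; apply/negP => v0_lt0.
have [M kM] := hk; pose lam := M + 1.
pose w y s := v y s * expR (- (lam * s)).
have wcont : {in Omega, forall y, {within `[0, T], continuous (w y)}}.
  move=> y yO s; apply: cvgM; first exact: hC0.
  apply: continuous_subspaceT => r.
  apply: continuous_comp; last exact: continuous_expR.
  by apply: cvgN; apply: cvgM; [exact: cvg_cst|exact: cvg_id].
have [y [s [yO sT wmin]]] := finite_family_min x0O (ltW hT) wcont.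
have v_lt0 : v y s < 0.
  have : w y s < 0.
    by apply: le_lt_trans (wmin _ _ x0O t0T) _; rewrite pmulr_llt0 ?expR_gt0.
  by rewrite pmulr_llt0 ?expR_gt0.
have s_gt0 : 0 < s.
  have /andP[s0 _] := sT; rewrite lt_neqAle s0 andbT; apply/eqP => s_eq0.
  by move: v_lt0; rewrite -s_eq0 ltNge hinit.
have sT' : 0 < s <= T by rewrite s_gt0; case/andP: sT.
have space_min_Omega z : z \in Omega -> v y s <= v z s.
  by move=> zO; have := wmin z s zO sT; rewrite ler_pM2r ?expR_gt0.
have space_min : {in gclosure G Omega, forall z, v y s <= v z s}.
  move=> z; rewrite finset.in_setU => /orP[|zB]; first exact: space_min_Omega.
  have [vz0|vz0] := leP 0 (v z s); first exact: le_trans (ltW v_lt0) vz0.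
  have [z' z'O] := boundary_controlled z s zB sT vz0.
  exact/le_trans/space_min_Omega.
(* The minimality of [w] at time [s], read for [v], bounds [v y] from below
   by an exponential that agrees with it at [s]. *)
have dv_le : derive_within `]0, T] (v y) s <= lam * v y s.
  apply: (@derive_within_le_of_left_minorant _ _ _
    (fun r => v y s * expR (lam * (r - s))) 0 _ _ s_gt0).
  - move=> r; rewrite /= !in_itv/= => /andP[-> rs] /=.
    by case/andP: sT => _; apply/le_trans/ltW.
  - by apply: (hC1 y yO).1; rewrite /= in_itv.
  - exact: is_derive_exp_through.
  - by rewrite subrr mulr0 expR0 mulr1.
  move=> r /andP[r0 rs].
  have rT : 0 <= r <= T.
    by rewrite ltW//=; case/andP: sT => _; apply/le_trans/ltW.
  have := wmin y r yO rT; rewrite /w -ler_pdivlMr ?expR_gt0//.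
  rewrite -expRN opprK -mulrA -expRD => w_le.
  have -> : lam * (r - s) = - (- (lam * r) + lam * s) by ring.
  by rewrite expRN ler_pdivrMr ?expR_gt0.
have := hpde y s yO sT'.
have := @laplacian_ge0_at_min _ _ G _ (fun z => v z s) _ space_min.
have k_le : k y s <= M := le_trans (ler_norm _) (kM y s yO sT').
(* Here [lam * v >= v_t >= k * v] with [v < 0] and [k <= M < lam]. *)
set L := laplacian _ _ _ _; set d := derive_within _ _ _ in dv_le *.
move: v_lt0 dv_le; rewrite /lam; nra.
Qed.
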